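(* Let $\boldsymbol{\mu}=(\mu_1,\dots,\mu_n)$ be an $n$-tuple of umbral monomials, let $\boldsymbol{\nu}_1,\ldots,\boldsymbol{\nu}_n$ be $m$-tuples of umbral monomials and, for $\boldsymbol{i}\in\mathbb{N}_0^m$, let $B_{\boldsymbol{i}}(x_1,\ldots,x_n)$ denote the generalized Bell polynomial associated with $\boldsymbol{\nu}_1,\dots,\boldsymbol{\nu}_n$. Then $$B_{\boldsymbol{i}}(\mu_1,\ldots,\mu_n)\simeq(\mu_1\boldsymbol{.}\beta\boldsymbol{.}\boldsymbol{\nu}_1+\cdots+\mu_n\boldsymbol{.}\beta\boldsymbol{.}\boldsymbol{\nu}_n)^{\boldsymbol{i}},$$ where $B_{\boldsymbol{i}}(\mu_1,\dots,\mu_n)$ is the umbral polynomial obtained by substituting $x_j\mapsto\mu_j$; that is, both sides have the same evaluation under $E$.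
   Context: $R$ is the real or complex field, $A$ is a set (the alphabet) whose elements are called umbrae, and $E:R[A]\to R$ is a linear functional (evaluation) with $E[1]=1$ and $E[\alpha^i\gamma^j\cdots]=E[\alpha^i]E[\gamma^j]\cdots$ for distinct umbrae and nonnegative integers $i,j,\dots$. Umbral equivalence $p\simeq q$ means $E[p]=E[q]$. Umbral monomials are monomials in $R[A]$; supports of the components of a tuple need not be disjoint. An $m$-tuple $\boldsymbol{\nu}$ of umbral monomials has moments $E[\boldsymbol{\nu}^{\boldsymbol{k}}]$, $\boldsymbol{\nu}^{\boldsymbol{k}}=\nu_1^{k_1}\cdots\nu_m^{k_m}$, $\boldsymbol{k}\in\mathbb{N}_0^m$, and generating function $f(\boldsymbol{\nu},\boldsymbol{t}_{(m)})=1+\sum_{\boldsymbol{k}\ne\boldsymbol{0}}E[\boldsymbol{\nu}^{\boldsymbol{k}}]\boldsymbol{t}_{(m)}^{\boldsymbol{k}}/\boldsymbol{k}!$, where $\boldsymbol{t}_{(m)}=(t_1,\dots,t_m)$, $\boldsymbol{k}!=k_1!\cdots k_m!$. Generalized Bell polynomial: $B_{\boldsymbol{i}}(x_1,\dots,x_n)\in R[x_1,\dots,x_n]$ is the coefficient of $\boldsymbol{t}_{(m)}^{\boldsymbol{i}}/\boldsymbol{i}!$ in $\exp\{\sum_{j=1}^n x_j[f(\boldsymbol{\nu}_j,\boldsymbol{t}_{(m)})-1]\}$. Partitions of a multi-index: a partition $\boldsymbol{\lambda}$ of $\boldsymbol{k}\in\mathbb{N}_0^m$, written $\boldsymbol{\lambda}\vdash\boldsymbol{k}$,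 is a matrix of nonnegative integers with $m$ rows, no zero column, columns in lexicographic order, and $r$-th row sum equal to $k_r$ (for $\boldsymbol{k}=\boldsymbol{0}$ only the empty one). Its number of columns is $l(\boldsymbol{\lambda})$. Writing $\boldsymbol{\lambda}=(\boldsymbol{\lambda}_1^{r_1},\boldsymbol{\lambda}_2^{r_2},\dots)$ when the distinct column $\boldsymbol{\lambda}_s$ occurs $r_s$ times, set $\mathfrak{m}(\boldsymbol{\lambda})!=r_1!r_2!\cdots$ and $\boldsymbol{\lambda}!=\prod_s(\boldsymbol{\lambda}_s!)^{r_s}$. With $h^{(j)}_{\boldsymbol{k}}=E[\boldsymbol{\nu}_j^{\boldsymbol{k}}]$ set $h^{(j)}_{\boldsymbol{\lambda}}=\prod_s(h^{(j)}_{\boldsymbol{\lambda}_s})^{r_s}$. The auxiliary umbra $\mu_1\boldsymbol{.}\beta\boldsymbol{.}\boldsymbol{\nu}_1+\cdots+\mu_n\boldsymbol{.}\beta\boldsymbol{.}\boldsymbol{\nu}_n$ ($\beta$ denotes the Bell umbra) is the symbolic $m$-tuple whose moments are computed by first treating $\mu_1,\dots,\mu_n$ as constants (indeterminates), with the summands mutually uncorrelated and $(\mu_j\boldsymbol{.}\beta\boldsymbol{.}\boldsymbol{\nu}_j)^{\boldsymbol{k}}$ evaluated to $\sum_{\boldsymbol{\lambda}\vdash\boldsymbol{k}}\frac{\boldsymbol{k}!}{\mathfrak{m}(\boldsymbol{\lambda})!\boldsymbol{\lambda}!}\mu_j^{l(\boldsymbol{\lambda})}h^{(j)}_{\boldsymbol{\lambda}}$,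 and then applying $E$ to the resulting polynomial in $\mu_1,\dots,\mu_n$. Explicitly its $\boldsymbol{i}$-th moment is $$\sum_{\boldsymbol{k}_1+\cdots+\boldsymbol{k}_n=\boldsymbol{i}}\frac{\boldsymbol{i}!}{\boldsymbol{k}_1!\cdots\boldsymbol{k}_n!}\sum_{\boldsymbol{\lambda}^{(1)}\vdash\boldsymbol{k}_1,\dots,\boldsymbol{\lambda}^{(n)}\vdash\boldsymbol{k}_n}\Big(\prod_{j=1}^n\frac{\boldsymbol{k}_j!}{\mathfrak{m}(\boldsymbol{\lambda}^{(j)})!\,\boldsymbol{\lambda}^{(j)}!}h^{(j)}_{\boldsymbol{\lambda}^{(j)}}\Big)E\big[\mu_1^{l(\boldsymbol{\lambda}^{(1)})}\cdots\mu_n^{l(\boldsymbol{\lambda}^{(n)})}\big].$$ *)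

(* Defs.v *)
From HB Require Import structures.
From mathcomp Require Import all_boot all_order all_algebra.
From mathcomp Require Import reals complex.
From mathcomp Require Import finmap.
(* [monalg] and [mpoly] share some notations: with this order of imports,
   ['X_{1..m}], [mdeg] and ['X_j] are those of [mpoly]; only
   [{mpoly R[n]}] has to be redirected, as [monalg] puts it in [type_scope]. *)
From mathcomp Require Import monalg mpoly.

Set Implicit Arguments.
Unset Strict Implicit.
Unset Printing Implicit Defensive.

Import GRing.Theory.

Local Open Scope ring_scope.

Notation "{ 'mpoly' T [ n ] }" := (mpoly.mpoly n T) : type_scope.

Inductive real_or_complex : numFieldType -> Prop :=
| Real_field (R : realType) : real_or_complex R
| Complex_field (R : realType) : real_or_complex (complex R).

(* Multi-indices in N^m are the monomial exponents ['X_{1..m}] of [mpoly], and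
   ['X_{1..m < b}] is the finite type of those of total degree less than b. *)

Definition mnm_fact (m : nat) (k : 'X_{1..m}) : nat := (\prod_(r < m) (k r)`!)%N.

Section MultiIndexPartitions.
Variable m : nat.
Implicit Types (k a b : 'X_{1..m}) (s : seq 'X_{1..m}).

(* Plain lexicographic order on columns; the order of [mpoly] on ['X_{1..m}]
   is graded, hence different. *)
Definition lex_le a b : bool :=
  @Order.le _ (seqlexi nat) (tval (multinom_val a)) (tval (multinom_val b)).

(* A matrix with m rows is given by the sequence of its columns. *)
Definition is_mpart k s : bool :=
  [&& 0%MM \notin s, sorted lex_le s & (\sum_(c <- s) c)%MM == k].

(* The bounds only serve to get a finite type: see [mpart_complete]. *)
Definition mpart k : predArgType :=
  {s : {bseq mdeg k of 'X_{1..m < (mdeg k).+1}} |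
     is_mpart k [seq bmnm c | c <- bseqval s]}.

HB.instance Definition _ k := Finite.on (mpart k).

Definition mcols k (lam : mpart k) : seq 'X_{1..m} :=
  [seq bmnm c | c <- bseqval (val lam)].

Definition mlen k (lam : mpart k) : nat := size (mcols lam).

Definition mult_fact k (lam : mpart k) : nat :=
  (\prod_(c <- undup (mcols lam)) (count_mem c (mcols lam))`!)%N.

Definition mpart_fact k (lam : mpart k) : nat :=
  (\prod_(c <- undup (mcols lam)) mnm_fact c ^ count_mem c (mcols lam))%N.

Definition mpart_prod (R : comNzRingType) (h : 'X_{1..m} -> R) k (lam : mpart k)
  : R :=
  \prod_(c <- undup (mcols lam)) h c ^+ count_mem c (mcols lam).

Lemma mpart_complete k s :
  is_mpart k s -> exists lam : mpart k, mcols lam = s.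
Proof.
move=> sP; have /and3P[s0 _ /eqP sk] := sP.
have degk : mdeg k = (\sum_(c <- s) mdeg c)%N by rewrite -sk mdeg_sum.
have sz : (size s <= mdeg k)%N.
  rewrite degk -sum1_size big_seq [leqRHS]big_seq; apply: leq_sum => c cs.
  by rewrite lt0n mdeg_eq0; apply: contraNneq s0 => <-.
have bd c : c \in s -> (mdeg c < (mdeg k).+1)%N.
  by move=> cs; rewrite ltnS degk (big_rem c) //= leq_addr.
pose t : seq 'X_{1..m < (mdeg k).+1} := pmap insub s.
have tE : [seq bmnm c | c <- t] = s.
  rewrite /t; elim: s bd {s0 sk sP degk sz t} => //= c s IHs bd.
  rewrite insubT ?bd ?mem_head //= => cb; rewrite IHs // => d ds.
  by rewrite bd // inE ds orbT.
have szt : (size t <= mdeg k)%N by rewrite -(size_map (@bmnm _ _)) tE.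
have tP : is_mpart k [seq bmnm c | c <- bseqval (Bseq szt)] by rewrite /= tE.
by exists (exist _ (Bseq szt) tP); rewrite /mcols /= tE.
Qed.

End MultiIndexPartitions.

(* Formal power series in t_1, ..., t_m are given by their coefficients. *)
Definition fps (m : nat) (S : Type) : Type := 'X_{1..m} -> S.

Section PowerSeries.
Variables (m : nat) (S : comNzRingType).
Implicit Types (f g : fps m S) (k : 'X_{1..m}).

Definition fps_one : fps m S := fun k => (k == 0%MM)%:R.

Definition fps_mul f g : fps m S := fun k =>
  \sum_(a : 'X_{1..m < (mdeg k).+1} | (a <= k)%MM) f a * g (k - a)%MM.

Definition fps_pow f (d : nat) : fps m S := iter d (fps_mul f) fps_one.

Lemma fps_pow_low f k d :
  f 0%MM = 0 -> (mdeg k < d)%N -> fps_pow f d k = 0.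
Proof.
move=> f0; elim: d k => // d IHd k kd; apply: big1 => a ak.
have [->|a0] := eqVneq (bmnm a) 0%MM; first by rewrite f0 mul0r.
rewrite [X in _ * X]IHd ?mulr0 //; rewrite ltnS in kd; apply: leq_trans kd.
rewrite -[X in (_ < mdeg X)%N](submK ak) mdegD -[ltnLHS]addn0 ltn_add2l.
by rewrite lt0n mdeg_eq0.
Qed.

End PowerSeries.

(* [\sum_d f ^ d / d!], for [f] without constant term; by [fps_pow_low] the
   omitted powers do not contribute to the coefficient [k]. *)
Definition fps_exp (m : nat) (R : fieldType) (S : comAlgType R) (f : fps m S)
  : fps m S := fun k =>
  \sum_(d < (mdeg k).+1) (d`!%:R)^-1 *: fps_pow f d k.

Section UmbralCalculus.
Variables (R : numFieldType) (A : choiceType).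

(* R[A], the umbrae being the elements of A; an umbral monomial is [<< mu >>]
   with mu : {cmonom A}. *)
Local Notation RA := {malg R[{cmonom A}]}.

Definition umbra (a : A) : RA := << ucm a >>.

Definition uncorrelated (E : RA -> R) : Prop :=
  forall (s : seq A) (e : A -> nat), uniq s ->
    E (\prod_(a <- s) umbra a ^+ e a) = \prod_(a <- s) E (umbra a ^+ e a).

Variable E : RA -> R.

Definition moment (m : nat) (nu : 'I_m -> {cmonom A}) (k : 'X_{1..m}) : R :=
  E (\prod_(r < m) << nu r >> ^+ k r).

Definition gen_fun (m : nat) (nu : 'I_m -> {cmonom A}) : fps m R :=
  fun k => if k == 0%MM then 1 else moment nu k / (mnm_fact k)%:R.

Section Tuples.
Variables (n m : nat) (nu : 'I_n -> 'I_m -> {cmonom A}).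

Definition bell_poly (i : 'X_{1..m}) : {mpoly R[n]} :=
  (mnm_fact i)%:R *:
    fps_exp (fun k => \sum_(j < n) (gen_fun (nu j) k - fps_one R k) *: 'X_j)
      i.

Definition umbral_subst (mu : 'I_n -> {cmonom A}) (p : {mpoly R[n]}) : RA :=
  mpoly.mmap (GRing.in_alg RA) (fun j => << mu j >>) p.

(* E[(mu_1.beta.nu_1 + ... + mu_n.beta.nu_n)^i].  The bound on the multi-indices
   k_j is implied by k_1 + ... + k_n = i. *)
Definition aux_moment (mu : 'I_n -> {cmonom A}) (i : 'X_{1..m}) : R :=
  \sum_(k : {ffun 'I_n -> 'X_{1..m < (mdeg i).+1}} |
          (\sum_(j < n) bmnm (k j))%MM == i)
    (mnm_fact i)%:R / (\prod_(j < n) (mnm_fact (k j))%:R) *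
    \sum_(lam : {dffun forall j : 'I_n, mpart (k j)})
      (\prod_(j < n)
         ((mnm_fact (k j))%:R / (mult_fact (lam j) * mpart_fact (lam j))%N%:R *
          mpart_prod (moment (nu j)) (lam j))) *
      E (\prod_(j < n) << mu j >> ^+ mlen (lam j)).

End Tuples.
End UmbralCalculus.

(* Main.v *)
(* For power series f_j without constant term, exp(sum_j f_j) = prod_j exp(f_j)
   and the coefficient of t^k in exp(f) is the sum over lambda |- k of
   prod_c f_c / m(lambda)!, c ranging over the columns of lambda.  Both follow
   from the divided multinomial formula
     (sum_x z_x)^d / d! = sum_{|e| = d} prod_x z_x^{e_x} / e_x!,
   applied to the f_j, resp. to the monomials f_c t^c of f: a partition of k is
   determined by the multiplicities e_c of its columns.  With
   f_j = x_j (f(nu_j, t) - 1) this expands B_i as a linear combination of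
   monomials in the x_j, to which the substitution and E apply termwise. *)
Require Import Defs.
From HB Require Import structures.
From mathcomp Require Import all_boot all_order all_algebra.
From mathcomp Require Import reals complex.
From mathcomp Require Import finmap.
From mathcomp Require Import monalg mpoly.
From mathcomp Require Import ring.

Set Implicit Arguments.
Unset Strict Implicit.
Unset Printing Implicit Defensive.

Import GRing.Theory.

Local Open Scope ring_scope.

(* [monalg] redefines this notation, for polynomials over [cmonom]. *)
Local Notation "{ 'mpoly' T [ n ] }" := (mpoly.mpoly n T) : type_scope.

(** * Divided powers and the multinomial formula *)

Section DividedPowers.
(* [w d] plays the role of [1 / d!], in rings with few inverses. *)
Variables (T : comNzRingType) (w : nat -> T).
Hypothesis w_fact : forall d, w d * d`!%:R = 1.

Lemma divided_bin d j : (j <= d)%N -> w d * 'C(d, j)%:R = w j * w (d - j).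
Proof.
(* Inserting the factors [w r * r! = 1] takes the place of dividing by factorials. *)
move=> jd; transitivity (w d * 'C(d, j)%:R * (w j * j`!%:R)
                          * (w (d - j) * (d - j)`!%:R)).
  by rewrite !w_fact !mulr1.
transitivity (w d * ('C(d, j) * (j`! * (d - j)`!))%:R * (w j * w (d - j))).
  by rewrite !natrM; ring.
by rewrite bin_fact // w_fact mul1r.
Qed.

(* The variable of [{poly T}] records the exponent of each [z p]. *)
Lemma divided_sum_coef (P : Type) (z : P -> T) (s : seq P) d D :
  (d < D)%N ->
  (\prod_(p <- s) \poly_(k < D) (w k * z p ^+ k))`_d
    = w d * (\sum_(p <- s) z p) ^+ d.
Proof.
elim: s d => [|p s IHs] d dD.
  rewrite !big_nil coef1 expr0n; case: d {dD} => [|d]; last by rewrite mulr0.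
  exact: esym (w_fact 0).
rewrite !big_cons coefM addrC exprDn mulr_sumr; apply: eq_bigr => -[j /=].
rewrite ltnS => jd _; rewrite coef_poly (leq_ltn_trans jd dD) IHs; last first.
  exact: leq_ltn_trans (leq_subr _ _) dD.
by rewrite -mulr_natl [RHS]mulrA divided_bin //; ring.
Qed.

(** Distributing the product of [divided_sum_coef] over its sums amounts to choosing an exponent
    [e p] for each [p]; the coefficient of degree [d] selects the choices of total [d]. *)
Lemma divided_sum (P : finType) (z : P -> T) d D : (d < D)%N ->
  w d * (\sum_p z p) ^+ d
    = \sum_(e : {ffun P -> 'I_D} | (\sum_p e p)%N == d)
        \prod_p (w (e p) * z p ^+ e p).
Proof.
move=> dD; rewrite -(divided_sum_coef _ _ dD).
under eq_bigr do rewrite poly_def.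
rewrite bigA_distr_bigA coef_sum [RHS]big_mkcond; apply: eq_bigr => e _.
rewrite scaler_prod coefZ -expr_sum coefXn eq_sym.
by case: eqP => _; rewrite ?mulr1 ?mulr0.
Qed.

End DividedPowers.

(** * Power series as truncated polynomials *)

Section TruncatedSeries.
Variables (m : nat) (S : comNzRingType).
Implicit Types (f g : fps m S) (k i : 'X_{1..m}) (p q : {mpoly S[m]}).

(** Gives access to the ring laws of polynomials without changing coefficients of degree below
    [b]. *)
Definition fps_trunc b f : {mpoly S[m]} :=
  \sum_(c : 'X_{1..m < b}) f c *: 'X_[c].

Lemma fps_trunc_coef b f k : (mdeg k < b)%N -> (fps_trunc b f)@_k = f k.
Proof. exact: mcoeff_mpoly. Qed.

Lemma lem_mdeg k a : (a <= k)%MM -> (mdeg a <= mdeg k)%N.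
Proof. by move/submK<-; rewrite mdegD leq_addl. Qed.

(** Only divisors of [k] enter this coefficient; asking for agreement there alone makes truncations
    eligible. *)
Lemma fps_mul_coef f g p q k :
  (forall a, (a <= k)%MM -> p@_a = f a /\ q@_a = g a) ->
  (p * q)@_k = fps_mul f g k.
Proof.
move=> fpgq; rewrite mcoeffM /fps_mul.
rewrite (eq_bigr (fun a : 'X_{1..m < (mdeg k).+1, (mdeg k).+1} =>
  f a.1 * g a.2)).
  rewrite [RHS]big_mkcond [LHS]big_mkcond /=.
  rewrite -(pair_bigA _ (fun a c : 'X_{1..m < (mdeg k).+1} =>
    if k == (a + c)%MM then f a * g c else 0)) /=; apply: eq_bigr => a _.
  case: ifPn => [ak|nak]; last first.
    apply: big1 => c _; case: eqP => // ka; case/negP: nak.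
    by have := lem_addr a c; rewrite -ka.
  have kab : (mdeg (k - a)%MM < (mdeg k).+1)%N by rewrite ltnS mdegB.
  rewrite (bigD1 (BMultinom kab)) //= addmC submK // eqxx big1 ?addr0 // => c.
  rewrite -val_eqE /= => cE; case: eqP => // ka; case/eqP: cE.
  have := addmK a c; rewrite addmC -ka; exact: esym.
move=> a /eqP ka.
have [-> _] : p@_a.1 = f a.1 /\ q@_a.1 = g a.1.
  by apply: fpgq; have := lem_addr a.1 a.2; rewrite -ka.
have [_ ->//] : p@_a.2 = f a.2 /\ q@_a.2 = g a.2.
by apply: fpgq; have := lem_addl a.1 a.2; rewrite -ka.
Qed.

Lemma fps_pow_trunc b f d k : (mdeg k < b)%N ->
  (fps_trunc b f ^+ d)@_k = fps_pow f d k.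
Proof.
elim: d k => [|d IHd] k kb; first by rewrite expr0 mcoeff1.
rewrite exprS; apply: fps_mul_coef => a ak.
have ab : (mdeg a < b)%N by apply: leq_ltn_trans kb; rewrite lem_mdeg.
by rewrite fps_trunc_coef ?IHd.
Qed.

Definition low_order (d : nat) p := forall k, (mdeg k < d)%N -> p@_k = 0.

Lemma low_orderM d e p q :
  low_order d p -> low_order e q -> low_order (d + e) (p * q).
Proof.
move=> dp eq k kde; rewrite mcoeffM big1 // => a /eqP ka.
have [ad|da] := ltnP (mdeg a.1) d; first by rewrite dp ?mul0r.
rewrite eq ?mulr0 // -(ltn_add2l d); apply: leq_ltn_trans kde.
apply: (@leq_trans (mdeg (a.1 + a.2)%MM)); last by rewrite -ka.
by rewrite mdegD leq_add2r.
Qed.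

Lemma low_orderX d p : p@_0%MM = 0 -> low_order d (p ^+ d).
Proof.
move=> p0; elim: d => [//|d IHd]; rewrite exprS -add1n; apply: low_orderM IHd.
by move=> k; rewrite ltnS leqn0 mdeg_eq0 => /eqP->.
Qed.

Lemma low_orderZ d c p : low_order d p -> low_order d (c *: p).
Proof. by move=> dp k /dp kp; rewrite mcoeffZ kp mulr0. Qed.

Lemma low_order_prod (P : finType) (z : P -> {mpoly S[m]}) (e : P -> nat) :
  (forall x, low_order (e x) (z x)) -> low_order (\sum_x e x) (\prod_x z x).
Proof.
by move=> ez; apply: (big_ind2 (fun q d => low_order d q)) => // p' d q e';
  exact: low_orderM.
Qed.

Lemma mcoeff_mul_eq b p p' q q' :
  (forall k, (mdeg k < b)%N -> p@_k = p'@_k) ->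
  (forall k, (mdeg k < b)%N -> q@_k = q'@_k) ->
  forall k, (mdeg k < b)%N -> (p * q)@_k = (p' * q')@_k.
Proof.
move=> pp qq k kb; rewrite !mcoeffM; apply: eq_bigr => a _.
by rewrite pp ?qq // (leq_ltn_trans _ kb) // -ltnS bmdeg.
Qed.

(** Terms of degree at least [b] cannot reach the coefficient [i], so each factor may be truncated
    to a sum over a finite type, over which the product distributes. *)
Lemma mcoeff_prod (P : finType) (z : P -> {mpoly S[m]}) i b : (mdeg i < b)%N ->
  (\prod_x z x)@_i
    = \sum_(k : {ffun P -> 'X_{1..m < b}} | (\sum_x bmnm (k x))%MM == i)
        \prod_x (z x)@_(k x).
Proof.
move=> ib.
have -> : (\prod_x z x)@_i = (\prod_x fps_trunc b (fun k => (z x)@_k))@_i.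
  move: i ib; apply: (big_ind2 (fun p q : {mpoly S[m]} =>
    forall k, (mdeg k < b)%N -> p@_k = q@_k)) => //.
    by move=> p p' q q'; apply: mcoeff_mul_eq.
  by move=> x _ k kb; rewrite fps_trunc_coef.
rewrite bigA_distr_bigA raddf_sum [RHS]big_mkcond; apply: eq_bigr => k _ /=.
rewrite scaler_prod mprodXE mcoeffZ mcoeffX.
by case: eqP => _; rewrite ?mulr1 ?mulr0.
Qed.
End TruncatedSeries.

(** * Exponentials of sums of power series *)

Section Exponential.
Variables (R : numFieldType) (S : comAlgType R) (m : nat).
Implicit Types (f g : fps m S) (k i : 'X_{1..m}).

Let w d : S := ((d`!%:R)^-1 : R)%:A.

Lemma fact_natr_neq0 d : d`!%:R != 0 :> R.
Proof. by rewrite Num.Theory.pnatr_eq0 -lt0n fact_gt0. Qed.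

Let w_fact d : w d * d`!%:R = 1.
Proof.
rewrite /w mulr_algl -[in LHS](scaler_nat d`! (1 : S)).
by rewrite scalerA mulVf ?scale1r ?fact_natr_neq0.
Qed.

(** Allows one summation bound for all coefficients, where [fps_exp] uses a bound depending on
    [k]. *)
Lemma fps_exp_widen b f k : (mdeg k < b)%N -> f 0%MM = 0 ->
  fps_exp f k = \sum_(d < b) w d * fps_pow f d k.
Proof.
move=> kb f0; rewrite /fps_exp.
rewrite (big_ord_widen b (fun d => (d`!%:R)^-1 *: fps_pow f d k)) //.
rewrite big_mkcond; apply: eq_bigr => d _; rewrite /w mulr_algl.
by case: ifPn => //; rewrite -leqNgt => kd; rewrite fps_pow_low ?scaler0.
Qed.

(** Common source of the next two lemmas, where the [z x] are the truncated summands of the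
    exponent, resp. the monomials of [f]. The exponents fill a whole box, so that the sum can later
    be factored. *)
Lemma fps_exp_coef (P : finType) (z : P -> {mpoly S[m]}) b f k :
  (mdeg k < b)%N -> (forall x, (z x)@_0%MM = 0) ->
  fps_trunc b f = \sum_x z x ->
  fps_exp f k = \sum_(e : {ffun P -> 'I_b})
                  (\prod_x (w (e x) *: z x ^+ e x))@_k.
Proof.
move=> kb z0 fz.
have f0 : f 0%MM = 0.
  rewrite -(@fps_trunc_coef _ _ b) ?mdeg0 ?(leq_ltn_trans _ kb) // fz raddf_sum.
  by apply: big1 => x _; apply: z0.
rewrite (fps_exp_widen kb f0).
transitivity (\sum_(d < b) \sum_(e : {ffun P -> 'I_b} | (\sum_x e x)%N == d)
    (\prod_x (w (e x) *: z x ^+ e x))@_k).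
  apply: eq_bigr => d _; rewrite -(fps_pow_trunc _ _ kb) -mcoeffCM fz.
  have wC_fact e : (w e)%:MP * e`!%:R = 1 :> {mpoly S[m]}.
    by rewrite -mpolyC_nat -mpolyCM w_fact.
  rewrite (divided_sum wC_fact z (ltn_ord d)) raddf_sum; apply: eq_bigr => e _.
  by congr (_@__); apply: eq_bigr => x _; rewrite mul_mpolyC.
rewrite (exchange_big_dep xpredT) //=; apply: eq_bigr => e _.
(* Exponents of total at least [b] belong to no [d < b]; their product has order at least
   [b > mdeg k], since no [z x] has a constant term, so its coefficient is 0. *)
have [eb|be] := ltnP (\sum_x e x) b.
  by rewrite (big_pred1 (Ordinal eb)) // => d; rewrite eq_sym.
rewrite big_pred0 => [|d]; last first.
  by apply/negbTE; rewrite neq_ltn (leq_trans _ be) ?orbT.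
apply/esym; apply: (low_order_prod (e := fun x => nat_of_ord (e x))).
  by move=> x; apply/low_orderZ/low_orderX.
exact: leq_trans be.
Qed.

Lemma fps_exp_sum (P : finType) (f : P -> fps m S) k :
  (forall x, f x 0%MM = 0) ->
  fps_exp (fun a => \sum_x f x a) k
    = \sum_(a : {ffun P -> 'X_{1..m < (mdeg k).+1}} |
              (\sum_x bmnm (a x))%MM == k) \prod_x fps_exp (f x) (a x).
Proof.
move=> f0; set b := (mdeg k).+1; have kb : (mdeg k < b)%N by [].
rewrite (@fps_exp_coef P (fun x => fps_trunc b (f x)) b _ k kb); first last.
- rewrite /fps_trunc exchange_big; apply: eq_bigr => c _.
  by rewrite scaler_suml.
- by move=> x; rewrite fps_trunc_coef ?mdeg0.
rewrite -raddf_sum.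
(* The sum over the box factors into one truncated exponential for each [x]. *)
rewrite -(bigA_distr_bigA (fun x (e : 'I_b) => w e *: fps_trunc b (f x) ^+ e)) /=.
rewrite (mcoeff_prod _ kb); apply: eq_bigr => a _; apply: eq_bigr => x _.
rewrite (@fps_exp_widen b) ?bmdeg // raddf_sum; apply: eq_bigr => e _.
by rewrite /= mcoeffZ fps_pow_trunc ?bmdeg.
Qed.

Lemma fps_exp_monomials f k : f 0%MM = 0 ->
  fps_exp f k
    = \sum_(e : {ffun 'X_{1..m < (mdeg k).+1} -> 'I_(mdeg k).+1} |
              (\sum_c bmnm c *+ e c)%MM == k)
        \prod_c (w (e c) * f c ^+ e c).
Proof.
move=> f0; rewrite (@fps_exp_coef _ (fun c : 'X_{1..m < (mdeg k).+1} =>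
  f c *: 'X_[c]) (mdeg k).+1) //; last first.
  move=> c; rewrite mcoeffZ mcoeffX.
  by case: eqP => [->|]; rewrite ?f0 ?mul0r ?mulr0.
rewrite [RHS]big_mkcond; apply: eq_bigr => e _.
under eq_bigr do rewrite exprZn scalerA mpolyXn.
rewrite scaler_prod mprodXE mcoeffZ mcoeffX.
by case: eqP => _; rewrite ?mulr1 ?mulr0.
Qed.

End Exponential.

(** * Partitions of a multi-index as multiplicity functions *)

Section Partitions.
Variables (m : nat) (k : 'X_{1..m}).
Local Notation C := 'X_{1..m < (mdeg k).+1}.
Local Notation D := 'I_(mdeg k).+1.
Implicit Types (lam : mpart k) (c : C) (e : {ffun C -> D}).

Lemma lex_le_total : total (@lex_le m).
Proof. by move=> a b; apply: Order.TotalTheory.le_total. Qed.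

Lemma lex_le_trans : transitive (@lex_le m).
Proof. by move=> b a c; apply: Order.POrderTheory.le_trans. Qed.

Lemma lex_le_anti : antisymmetric (@lex_le m).
Proof.
by move=> a b ab; apply/val_inj/val_inj/(@Order.POrderTheory.le_anti _ (seqlexi nat)).
Qed.

Lemma mcols_mpart lam : is_mpart k (mcols lam).
Proof. exact: valP lam. Qed.

Lemma count_mcols lam c :
  count_mem (bmnm c) (mcols lam) = count_mem c (bseqval (val lam)).
Proof. by rewrite count_map; apply: eq_count => d /=; rewrite -val_eqE. Qed.

Definition mpart_mult lam : {ffun C -> D} :=
  [ffun c => inord (count_mem (bmnm c) (mcols lam))].

Lemma mpart_multE lam c : mpart_mult lam c = count_mem (bmnm c) (mcols lam) :> nat.
Proof.
(* [inord] never takes its default value: a partition of [k] has at most [mdeg k] columns. *)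
rewrite ffunE inordK // ltnS (leq_trans (count_size _ _)) //.
by rewrite size_map size_bseq.
Qed.

(** Absent columns have multiplicity 0 and contribute a factor 1. *)
Lemma prod_mcols (S : comNzRingType) (q : 'X_{1..m} -> nat -> S) lam :
  (forall a, q a 0%N = 1) ->
  \prod_(a <- undup (mcols lam)) q a (count_mem a (mcols lam))
    = \prod_(c : C) q c (mpart_mult lam c).
Proof.
move=> q0; rewrite /mcols undup_map_inj; last exact: val_inj.
rewrite big_map big_uniq ?undup_uniq //= [LHS]big_mkcond.
apply: eq_bigr => c _; rewrite mpart_multE mem_undup; case: ifPn => // /count_memPn cE.
by rewrite count_mcols cE q0.
Qed.

Lemma sum_count_mem (s : seq C) :
  (\sum_c bmnm c *+ count_mem c s = \sum_(c <- s) bmnm c)%MM.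
Proof.
elim: s => [|d s IHs]; first by rewrite big_nil big1.
rewrite big_cons -IHs /=.
rewrite (eq_bigr (fun c => bmnm c *+ (d == c) + bmnm c *+ count_mem c s)%MM) => [|c _].
  rewrite big_split /= (bigD1 d) //= eqxx mulm1n big1 ?addm0 // => c.
  by rewrite eq_sym => /negbTE->; rewrite mulm0n.
by case: (d == c); rewrite ?add1n ?mulmS ?mulm0n ?addm0 ?add0m ?add0n.
Qed.

(** Sorted sequences with the same multiplicities coincide, as the lexicographic order is
    antisymmetric. *)
Lemma mpart_mult_inj : injective mpart_mult.
Proof.
move=> lam lam' eq_mult; apply/val_inj/val_inj/(inj_map val_inj).
have /and3P[_ srt _] := mcols_mpart lam; have /and3P[_ srt' _] := mcols_mpart lam'.
apply: (sorted_eq lex_le_trans lex_le_anti srt srt').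
apply: perm_map; apply/allP => c _ /=.
by rewrite -!count_mcols -!mpart_multE eq_mult.
Qed.

Lemma mpart_mult_surj e :
  (\sum_c bmnm c *+ e c)%MM = k -> (forall c, bmnm c = 0%MM -> e c = ord0) ->
  exists lam, mpart_mult lam = e.
Proof.
move=> ek e0.
(* The partition sought is the sorted list containing each column [c] exactly [e c] times. *)
pose s : seq C := flatten [seq nseq (e c) c | c <- enum {: C}].
have count_s c : count_mem c s = e c.
  rewrite count_flatten -map_comp sumnE big_map big_enum (bigD1 c) //=.
  rewrite count_nseq /= eqxx mul1n big1 ?addn0 // => d /negbTE dc.
  by rewrite count_nseq /= dc.
have [lam lamE] : exists lam, mcols lam = sort (@lex_le m) (map val s).
  apply: mpart_complete; apply/and3P; split; last 1 first.
  - rewrite (perm_big _ (permEl (perm_sort _ _))) big_map -sum_count_mem -[X in _ == X]ek.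
    by apply/eqP; apply: eq_bigr => c _; rewrite count_s.
  - rewrite mem_sort; apply/negP => /mapP[c cs c0].
    have := count_s c; rewrite e0 // => /count_memPn /negP; exact.
  - exact: sort_sorted lex_le_total _.
exists lam; apply/ffunP => c; apply/val_inj; rewrite /= mpart_multE lamE.
rewrite (permP (permEl (perm_sort _ _))) count_map -count_s.
by apply: eq_count => d /=; rewrite -val_eqE.
Qed.

Lemma mpart_mult_sum lam : (\sum_c bmnm c *+ mpart_mult lam c)%MM = k.
Proof.
have /and3P[_ _ /eqP lamk] := mcols_mpart lam; apply: etrans lamk.
rewrite /mcols big_map -sum_count_mem; apply: eq_bigr => c _.
by rewrite mpart_multE count_mcols.
Qed.

Lemma mpart_mult0 lam c : bmnm c = 0%MM -> mpart_mult lam c = ord0.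
Proof.
move=> c0; apply/val_inj; rewrite /= mpart_multE c0; apply/count_memPn.
by have /and3P[] := mcols_mpart lam.
Qed.

(** In [fps_exp_monomials] the sum constraint leaves the multiplicity of the zero column free, but a
    nonzero one gives a factor [f 0 = 0]. The remaining functions, collected in [V], are exactly
    those coming from partitions. *)
Lemma fps_exp_mpart (R : numFieldType) (S : comAlgType R) (f : fps m S) :
  f 0%MM = 0 ->
  fps_exp f k = \sum_(lam : mpart k) (mult_fact lam)%:R^-1 *: mpart_prod f lam.
Proof.
move=> f0; rewrite fps_exp_monomials //.
pose G e : S := \prod_c ((e c)`!%:R^-1 %:A * f c ^+ e c).
pose V := [set e : {ffun C -> D} | ((\sum_c bmnm c *+ e c)%MM == k) &&
  [forall c, (bmnm c == 0%MM) ==> (e c == ord0)]].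
transitivity (\sum_(e in V) G e).
  rewrite big_mkcond [RHS]big_mkcond; apply: eq_bigr => e _; rewrite inE.
  case: eqP => //= ek; case: ifPn => // /forallPn[c].
  rewrite negb_imply => /andP[/eqP c0 ec0].
  by rewrite (bigD1 c) //= c0 f0 expr0n (negbTE (ec0 : e c != 0%N :> nat)) mulr0 mul0r.
have -> : V = mpart_mult @: [set: mpart k].
  apply/setP => e; rewrite inE; apply/andP/imsetP => [[/eqP ek /forallP e0]|[lam _ ->]].
    have [c c0|lam <-] := mpart_mult_surj ek; last by exists lam.
    by apply/eqP; apply: implyP (e0 c) _; apply/eqP.
  rewrite mpart_mult_sum; split=> //; apply/forallP => c; apply/implyP => /eqP c0.
  by rewrite mpart_mult0.
rewrite big_imset => [|lam lam' _ _]; last exact: mpart_mult_inj.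
rewrite big_set; apply: eq_bigr => lam _.
rewrite /G -(prod_mcols (q := fun a r => (r`!%:R^-1)%:A * f a ^+ r)); last first.
  by move=> a; rewrite invr1 scale1r mulr1.
rewrite /mult_fact /mpart_prod natr_prod -prodfV.
under eq_bigr do rewrite mulr_algl.
by rewrite scaler_prod.
Qed.

End Partitions.

(** Needed because the type of partitions of [k j] varies with [j]. Tagged elements bring all [T i]
    into one type, where ordinary distributivity applies. *)
Lemma prod_sum_dffun (S : comNzRingType) (I : finType) (T : I -> finType)
    (F : forall i, T i -> S) :
  \prod_i \sum_(t : T i) F i t
    = \sum_(g : {dffun forall i, T i}) \prod_i F i (g i).
Proof.
rewrite (reindex (@dffun_of_fprod I T)); last exact/onW_bij/dffun_of_fprod_bij.
under [LHS]eq_bigr do rewrite (big_tag (fun i t => F i t)).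
rewrite bigA_distr_big_dep.
have := big_fprod 1 (GRing.add : Monoid.add_law 0 *%R) (fun i => [ffun t => F i t]).
move/esym => /= E; apply: etrans (etrans _ E) _.
  apply: eq_bigr => g _; apply: eq_bigr => i _.
  by rewrite /untag; case: eqP => // e; rewrite ffunE.
apply: eq_bigr => g _; apply: eq_bigr => i _.
by rewrite !ffunE.
Qed.

(** * Substitution and evaluation of Bell polynomials *)

Section UmbralBell.
Variables (R : numFieldType) (A : choiceType) (E : {scalar {malg R[{cmonom A}]}}).
Variables (n m : nat).
Implicit Types (mu : 'I_n -> {cmonom A}) (nu : 'I_m -> {cmonom A}).
Implicit Types (k i : 'X_{1..m}).

Lemma mpart_prod_cols (S : comNzRingType) (h : 'X_{1..m} -> S) k (lam : mpart k) :
  mpart_prod h lam = \prod_(c <- mcols lam) h c.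
Proof. exact: prodr_undup_exp_count. Qed.

Lemma mpart_factE k (lam : mpart k) :
  (mpart_fact lam)%:R = \prod_(c <- mcols lam) (mnm_fact c)%:R :> R.
Proof.
rewrite -prodr_undup_exp_count /mpart_fact natr_prod.
by apply: eq_bigr => c _; rewrite natrX.
Qed.

Lemma mnm_fact_neq0 k : (mnm_fact k)%:R != 0 :> R.
Proof.
by rewrite natr_prod prodf_seq_neq0; apply/allP => r _; rewrite fact_natr_neq0.
Qed.

(** Each column [c], being nonzero, contributes its moment over [c!] and one factor [x]. *)
Lemma mpart_prod_gen_fun nu (S : comAlgType R) (x : S) k (lam : mpart k) :
  mpart_prod (fun a => (gen_fun E nu a - fps_one R a) *: x) lam
    = (mpart_prod (moment E nu) lam / (mpart_fact lam)%:R) *: x ^+ mlen lam.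
Proof.
rewrite !mpart_prod_cols mpart_factE -prodf_div /mlen.
have /and3P[s0 _ _] := mcols_mpart lam.
rewrite -(count_predT (mcols lam)) -iter_mulr_1 -big_const_seq -scaler_prod.
rewrite big_seq [RHS]big_seq.
apply: eq_bigr => c cs; rewrite /gen_fun /fps_one.
by case: eqP cs => [->|_ _]; rewrite ?(negbTE s0) ?subr0.
Qed.

Lemma umbral_subst_scale mu c p :
  E (umbral_subst mu (c *: p)) = c * E (umbral_subst mu p).
Proof. by rewrite /umbral_subst mmapZ /= mulr_algl linearZ. Qed.

Lemma umbral_subst_sum mu (I : finType) (P : pred I) (p : I -> {mpoly R[n]}) :
  E (umbral_subst mu (\sum_(x | P x) p x)) = \sum_(x | P x) E (umbral_subst mu (p x)).
Proof. by rewrite -(raddf_sum E) /umbral_subst (raddf_sum (mpoly.mmap _ _)). Qed.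

Lemma umbral_subst_monomial mu (l : 'I_n -> nat) :
  umbral_subst mu (\prod_j 'X_j ^+ l j)
    = \prod_j << mu j >> ^+ l j :> {malg R[{cmonom A}]}.
Proof.
rewrite /umbral_subst rmorph_prod; apply: eq_bigr => j _.
by rewrite rmorphXn /= mmapX mmap1U.
Qed.

End UmbralBell.

Theorem corollary3p2 (R : numFieldType) (R_base : real_or_complex R)
    (A : choiceType) (E : {scalar {malg R[{cmonom A}]}})
    (E1 : E 1 = 1) (E_uncorrelated : uncorrelated E)
    (n m : nat) (mu : 'I_n -> {cmonom A}) (nu : 'I_n -> 'I_m -> {cmonom A})
    (i : 'X_{1..m}) :
  E (umbral_subst mu (bell_poly E nu i)) = aux_moment E nu mu i.
Proof.
pose f j : fps m {mpoly R[n]} := fun k => (gen_fun E (nu j) k - fps_one R k) *: 'X_j.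
have f0 j : f j 0%MM = 0 by rewrite /f /gen_fun /fps_one eqxx subrr scale0r.
rewrite /bell_poly umbral_subst_scale (fps_exp_sum _ f0).
rewrite umbral_subst_sum mulr_sumr; apply: eq_bigr => a _.
under eq_bigr => j _ do rewrite (fps_exp_mpart _ (f0 j)).
rewrite prod_sum_dffun umbral_subst_sum !mulr_sumr; apply: eq_bigr => lam _.
under eq_bigr => j _ do rewrite mpart_prod_gen_fun scalerA.
rewrite scaler_prod umbral_subst_scale umbral_subst_monomial !mulrA.
(* After removing the common evaluation and [i!], the scalars agree for each [j]: the factor [k_j!]
   of the partition term cancels the denominator of the multinomial coefficient. *)
congr (_ * _); rewrite -[RHS]mulrA -prodfV -big_split; congr (_ * _).
apply: eq_bigr => j _ /=; rewrite natrM invfM.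
by rewrite !mulrA mulVf ?mnm_fact_neq0 // mul1r -!mulrA; congr (_ * _);
  rewrite mulrC.
Qed.
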